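(* Let $D$ be an open g-convex subset of the hyperbolic plane $\mathbb{H}^2$. Assume there exist a point $p_*\in\mathbb{H}^2$ and radii $R\ge r>0$ such that $$B(p_*,r)\subseteq D\subseteq B(p_*,R).$$ If $F\colon D\to\mathbb{R}$ is a $\theta$-barrier for $D$ with analytic center $p_*$, then $$\theta\ge\frac{1}{2^6}\cdot\sqrt r\cdot\frac rR-\frac12.$$
   Context: $\mathbb{H}^2$ is the hyperbolic plane: the complete simply connected Riemannian 2-manifold of constant sectional curvature $-1$, with metric $\langle\cdot,\cdot\rangle$ and distance $d$. $B(c,r)=\{p\in\mathbb{H}^2:d(c,p)<r\}$ is the open ball. A set $D\subseteq \mathbb{H}^2$ is geodesically convex (g-convex) if for all $p,q\in D$ the geodesic segment from $p$ to $q$ lies in $D$. Barriers. Let $D\subseteq\mathbb{H}^2$ be open and g-convex. For a three times continuously differentiable $F\colon D\to\mathbb{R}$, let $\nabla F(p)\in T_p\mathbb{H}^2$ be the Riemannian gradient, $(\nabla^2F)_p$ the Riemannian Hessian (a symmetric bilinear form on $T_p\mathbb{H}^2$), and $(\nabla^3F)_p$ the third covariant derivative, i.e. the covariant derivative of the Hessian (a trilinear form, in general not symmetric). $F$ is strongly $1$-self-concordant if for all $p\in D$ and $u,v,w\in T_p\mathbb{H}^2$, $$|(\nabla^3F)_p(u,v,w)|\le 2\sqrt{(\nabla^2F)_p(u,u)}\sqrt{(\nabla^2F)_p(v,v)}\sqrt{(\nabla^2F)_p(w,w)},$$ and the epigraph $\{(p,t): p\in D,\ t\ge F(p)\}$ is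 a closed subset of $\mathbb{H}^2\times\mathbb{R}$. For a finite real number $\theta\ge 0$, $F$ is a $\theta$-barrier for $D$ if it is strongly $1$-self-concordant, $(\nabla^2F)_p\succ0$ for all $p\in D$, and $\max_{0\neq v\in T_p\mathbb{H}^2}\frac{\langle\nabla F(p),v\rangle}{\sqrt{(\nabla^2F)_p(v,v)}}\le\sqrt\theta$ for all $p\in D$. If a $\theta$-barrier $F$ attains its minimum on $D$, the minimizer is unique and is called the analytic center of $F$. *)

(* Defs.v *)
From Stdlib Require Import Reals Lra.
From Coquelicot Require Import Coquelicot.
Open Scope R_scope.

(* The hyperbolic plane in the upper half-plane model: the global chart
   {(x, y) : y > 0} with the metric (dx^2 + dy^2) / y^2.  Points and tangent
   vectors are both coordinate pairs, and tensors are functions of the point and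
   of coordinate vectors.  A function on a subset D of the plane is a total
   function of R * R of which only the values on D matter. *)
Definition H2 (p : R * R) : Prop := 0 < snd p.

Definition metric (p u v : R * R) : R :=
  (fst u * fst v + snd u * snd v) / snd p ^ 2.

Definition ddir (f : R * R -> R) (p u : R * R) : R :=
  Derive (fun t => f (plus p (scal t u))) 0.

(* The vector representing the linear form alpha for [metric p]. *)
Definition sharp (p : R * R) (alpha : R * R -> R) : R * R :=
  (snd p ^ 2 * alpha (1, 0), snd p ^ 2 * alpha (0, 1)).

Lemma metric_sharp (p v : R * R) (a b : R) : H2 p ->
  metric p (sharp p (fun u => a * fst u + b * snd u)) v = a * fst v + b * snd v.
Proof. unfold H2, metric, sharp; simpl; intros Hp; field; lra. Qed.

(* Levi-Civita connection: nabla_u v at p for the constant coordinate fields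
   u and v, by the Koszul formula. *)
Definition christoffel (p u v : R * R) : R * R :=
  sharp p (fun w => (ddir (fun q => metric q v w) p u
                     + ddir (fun q => metric q u w) p v
                     - ddir (fun q => metric q u v) p w) / 2).

Lemma ddir_metric (p u v w : R * R) : H2 p ->
  ddir (fun q => metric q v w) p u = - 2 * snd u / snd p * metric p v w.
Proof.
unfold H2, ddir, metric; intros Hp; apply is_derive_unique; simpl.
unfold plus, scal; simpl; unfold mult; simpl.
auto_derive.
- rewrite Rmult_0_l, Rplus_0_r, Rmult_1_r.
  apply Rgt_not_eq, Rmult_lt_0_compat; exact Hp.
- field; lra.
Qed.

Lemma christoffelE (p u v : R * R) : H2 p ->
  christoffel p u v =
    (- (fst u * snd v + snd u * fst v) / snd p,
     (fst u * fst v - snd u * snd v) / snd p).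
Proof.
intros Hp; unfold christoffel, sharp; rewrite !ddir_metric by exact Hp.
unfold metric; simpl; unfold H2 in Hp; f_equal; field; lra.
Qed.

Definition gradient (F : R * R -> R) (p : R * R) : R * R := sharp p (ddir F p).

Definition hessian (F : R * R -> R) (p u v : R * R) : R :=
  ddir (fun q => ddir F q u) p v - ddir F p (christoffel p u v).

(* (nabla_w (nabla^2 F)) (u, v). *)
Definition cov3 (F : R * R -> R) (p u v w : R * R) : R :=
  ddir (fun q => hessian F q u v) p w
  - hessian F p (christoffel p w u) v - hessian F p u (christoffel p w v).

(* F is C^(n+1) iff it is Frechet differentiable with C^n differential. *)
Fixpoint Ck (n : nat) (D : R * R -> Prop) (F : R * R -> R) : Prop :=
  match n with
  | O => forall p, D p -> continuous F p
  | S n' => (forall p, D p -> ex_filterdiff F (locally p))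
            /\ forall u, Ck n' D (fun q => ddir F q u)
  end.

Definition C1_path (p q : R * R) (c c' : R -> R * R) : Prop :=
  c 0 = p /\ c 1 = q /\
  forall t, 0 <= t <= 1 -> H2 (c t) /\ is_derive c t (c' t) /\ continuous c' t.

Definition path_length (c c' : R -> R * R) : R :=
  RInt (fun t => sqrt (metric (c t) (c' t) (c' t))) 0 1.

Definition dist (p q : R * R) : R :=
  real (Glb_Rbar (fun l => exists c c', C1_path p q c c' /\ l = path_length c c')).

Definition Hball (c : R * R) (r : R) (p : R * R) : Prop := H2 p /\ dist c p < r.

(* By completeness every geodesic segment extends to a geodesic on all of R. *)
Definition geodesic (c : R -> R * R) : Prop :=
  exists c' : R -> R * R, forall t,
    H2 (c t) /\ is_derive c t (c' t)
    /\ is_derive c' t (opp (christoffel (c t) (c' t) (c' t))).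

Definition g_convex (D : R * R -> Prop) : Prop :=
  forall c, geodesic c -> D (c 0) -> D (c 1) ->
    forall t, 0 <= t <= 1 -> D (c t).

(* The epigraph is closed in H2 x R: its complement there is open (H2 x R is
   itself open in the ambient space). *)
Definition closed_epigraph (D : R * R -> Prop) (F : R * R -> R) : Prop :=
  open (fun z : (R * R) * R => H2 (fst z) /\ ~ (D (fst z) /\ F (fst z) <= snd z)).

Definition strongly_self_concordant (D : R * R -> Prop) (F : R * R -> R) : Prop :=
  Ck 3 D F
  /\ (forall p u v w, D p ->
        Rabs (cov3 F p u v w)
        <= 2 * sqrt (hessian F p u u) * sqrt (hessian F p v v)
             * sqrt (hessian F p w w))
  /\ closed_epigraph D F.

Definition barrier (theta : R) (D : R * R -> Prop) (F : R * R -> R) : Prop :=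
  0 <= theta
  /\ strongly_self_concordant D F
  /\ (forall p v, D p -> v <> (0, 0) -> 0 < hessian F p v v)
  /\ (forall p v, D p -> v <> (0, 0) ->
        metric p (gradient F p) v / sqrt (hessian F p v v) <= sqrt theta).

Definition analytic_center (D : R * R -> Prop) (F : R * R -> R) (p : R * R) : Prop :=
  D p /\ forall q, D q -> F p <= F q.

(* Main.v *)
Require Import Defs.
From Stdlib Require Import Reals Lra.
From Coquelicot Require Import Coquelicot.
Open Scope R_scope.

(** Along a unit-speed geodesic from the center with tangent [T] and parallel unit
    normal [n], put [f' = dF(T)], [phi = Hess F(T,T)] and [h = Hess F(n,n)].
    Negative curvature enters through the Ricci identity, by which
    [nabla^3 F(n,n,T)] and [nabla^3 F(n,T,n)] differ by [dF(T)]; self-concordance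
    bounds each by [2 h sqrt phi], so [f' <= 4 h sqrt phi].  Self-concordance
    also controls the growth of [phi] and [h] from their values at the center,
    where [f'] vanishes.  If the geodesic starts in the one of two orthogonal
    directions with the larger Hessian, these facts at distance 1 force
    [sqrt (phi 0) >= 1/8], hence [f' >= 1/72] from distance 1 on.  Finally
    [f'^2 <= theta phi] says that [1/f'] decreases at rate at least [1/theta], so
    a geodesic staying in the domain up to time [t] gives [t - 1 <= 72 theta].
    This bound, linear in [r], beats the claimed one as soon as the latter is
    positive, because that requires [r >= 2^10]. *)

(** * Directional derivatives and the chain rule along plane curves *)

Lemma is_derive_pair (x y : R -> R) (t x' y' : R) :
  is_derive x t x' -> is_derive y t y' ->
  is_derive (fun s => (x s, y s)) t (x', y').
Proof.
intros Hx Hy.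
apply (filterdiff_comp'_2 x y pair t (fun s => scal s x') (fun s => scal s y') pair
         Hx Hy).
apply (filterdiff_ext (fun u : R * R => u)); [now intros [u v]|].
apply (filterdiff_ext_lin _ (fun u : R * R => u)); [|now intros [u v]].
apply filterdiff_id.
Qed.

Lemma locally_curve (c : R -> R * R) (t : R) (c' : R * R) (P : R * R -> Prop) :
  is_derive c t c' -> locally (c t) P -> locally t (fun s => P (c s)).
Proof.
intros Hc HP.
refine (ex_derive_continuous (V := prod_NormedModule _ R_NormedModule R_NormedModule)
          c t _ P HP).
now exists c'.
Qed.

Lemma filterdiff_along (G : R * R -> R) (l : R * R -> R) (c : R -> R * R) (t : R)
    (c' : R * R) :
  filterdiff G (locally (c t)) l -> is_derive c t c' ->
  is_derive (fun s => G (c s)) t (l c').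
Proof.
intros HG Hc.
apply (filterdiff_ext_lin (U := R_NormedModule) _
         (fun s : R => l (scal (V := prod_ModuleSpace _ R_ModuleSpace R_ModuleSpace) s c'))).
- exact (filterdiff_comp' c G t (fun s => scal s c') l Hc HG).
- intros s; apply (linear_scal l (proj1 HG)).
Qed.

Lemma line_0 (p u : R * R) : plus p (scal 0 u) = p.
Proof. exact (eq_trans (f_equal (plus p) (scal_zero_l u)) (plus_zero_r p)). Qed.

Lemma is_derive_line (p u : R * R) (t : R) :
  is_derive (fun s => plus p (scal s u)) t u.
Proof.
destruct p as [p1 p2], u as [u1 u2].
apply (is_derive_pair (fun s => p1 + s * u1) (fun s => p2 + s * u2));
  auto_derive; trivial; ring.
Qed.

Lemma locally_line (p u : R * R) (P : R * R -> Prop) :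
  locally p P -> locally 0 (fun s : R => P (plus p (scal s u))).
Proof.
intros HP; refine (locally_curve (fun s => plus p (scal s u)) 0 u P (is_derive_line p u 0) _).
now rewrite line_0.
Qed.

Lemma filterdiff_ddir (G : R * R -> R) (l : R * R -> R) (p u : R * R) :
  filterdiff G (locally p) l -> ddir G p u = l u.
Proof.
intros HG; apply is_derive_unique, filterdiff_along; [|apply is_derive_line].
now rewrite line_0.
Qed.

Lemma is_derive_along (G : R * R -> R) (c : R -> R * R) (t : R) (c' : R * R) :
  ex_filterdiff G (locally (c t)) -> is_derive c t c' ->
  is_derive (fun s => G (c s)) t (ddir G (c t) c').
Proof.
intros [l Hl] Hc; rewrite (filterdiff_ddir _ _ _ _ Hl).
now apply filterdiff_along.
Qed.

Lemma ddirE (G : R * R -> R) (p u : R * R) :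
  ex_filterdiff G (locally p) ->
  ddir G p u = fst u * ddir G p (1, 0) + snd u * ddir G p (0, 1).
Proof.
intros [l Hl]; rewrite !(filterdiff_ddir _ _ _ _ Hl).
assert (Hlin := proj1 Hl).
transitivity (l (plus (scal (fst u) (1, 0)) (scal (snd u) (0, 1)))).
- f_equal; destruct u; unfold plus, scal; simpl;
    unfold prod_plus, prod_scal, scal, plus; simpl; unfold mult; simpl; f_equal; ring.
- rewrite (linear_plus l Hlin), !(linear_scal l Hlin); reflexivity.
Qed.

Lemma ddir_ext_loc (G K : R * R -> R) (p u : R * R) :
  locally p (fun q => G q = K q) -> ddir G p u = ddir K p u.
Proof.
intros HGK; apply Derive_ext_loc.
exact (locally_line p u _ HGK).
Qed.

(* [auto_derive] leaves eta-expanded derivatives, which [is_derive_unique] does not match. *)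
Lemma Derive_eta (g : R -> R) (t l : R) :
  is_derive g t l -> Derive (fun s : R => g s) t = l.
Proof. apply is_derive_unique. Qed.

(** * Smoothness classes, coordinate partials and their symmetry *)

Lemma Ck_pred (n : nat) (D : R * R -> Prop) (G : R * R -> R) :
  Ck (S n) D G -> Ck n D G.
Proof.
revert G; induction n as [|n IHn]; intros G [HG HG']; simpl.
- intros p Hp; now apply (filterdiff_continuous G), HG.
- split; [exact HG|]; intros u; apply IHn, HG'.
Qed.

Lemma Ck_diff (n : nat) (D : R * R -> Prop) (G : R * R -> R) (p : R * R) :
  Ck (S n) D G -> D p -> ex_filterdiff G (locally p).
Proof. intros [HG _]; apply HG. Qed.

Lemma Ck_ddir (n : nat) (D : R * R -> Prop) (G : R * R -> R) (u : R * R) :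
  Ck (S n) D G -> Ck n D (fun q => ddir G q u).
Proof. intros [_ HG]; apply HG. Qed.

Lemma Ck_cont (n : nat) (D : R * R -> Prop) (G : R * R -> R) (p : R * R) :
  Ck n D G -> D p -> continuous G p.
Proof.
induction n as [|n IHn]; intros HG; [apply HG|].
now apply IHn, Ck_pred.
Qed.

Lemma ddir_fst (G : R * R -> R) (x y : R) :
  ddir G (x, y) (1, 0) = Derive (fun s => G (s, y)) x.
Proof.
unfold ddir.
transitivity (Derive (fun t => G ((x + t, y))) 0).
- apply Derive_ext; intros t; unfold plus, scal; simpl;
    unfold prod_plus, prod_scal, scal, plus; simpl; unfold mult; simpl.
  now rewrite Rmult_1_r, Rmult_0_r, Rplus_0_r.
- unfold Derive; f_equal; apply Lim_ext; intros h.
  now rewrite Rplus_0_l, Rplus_0_r.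
Qed.

Lemma ddir_snd (G : R * R -> R) (x y : R) :
  ddir G (x, y) (0, 1) = Derive (fun s => G (x, s)) y.
Proof.
unfold ddir.
transitivity (Derive (fun t => G ((x, y + t))) 0).
- apply Derive_ext; intros t; unfold plus, scal; simpl;
    unfold prod_plus, prod_scal, scal, plus; simpl; unfold mult; simpl.
  now rewrite Rmult_1_r, Rmult_0_r, Rplus_0_r.
- unfold Derive; f_equal; apply Lim_ext; intros h.
  now rewrite Rplus_0_l, Rplus_0_r.
Qed.

Lemma ex_derive_fst (G : R * R -> R) (x y : R) :
  ex_filterdiff G (locally (x, y)) -> ex_derive (fun s => G (s, y)) x.
Proof.
intros HG; eexists; apply (is_derive_along G (fun s => (s, y)) x (1, 0) HG).
apply is_derive_pair; auto_derive; auto.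
Qed.

Lemma ex_derive_snd (G : R * R -> R) (x y : R) :
  ex_filterdiff G (locally (x, y)) -> ex_derive (fun s => G (x, s)) y.
Proof.
intros HG; eexists; apply (is_derive_along G (fun s => (x, s)) y (0, 1) HG).
apply is_derive_pair; auto_derive; auto.
Qed.

Lemma continuous_continuity_2d_pt (f : R -> R -> R) (x y : R) :
  continuous (fun q : R * R => f (fst q) (snd q)) (x, y) -> continuity_2d_pt f x y.
Proof.
intros Hf; apply continuity_2d_pt_filterlim.
apply filterlim_ext with (2 := Hf); now intros [u v].
Qed.

(** Schwarz's theorem, applied on a neighbourhood inside the open [D] once directional derivatives
    along the axes are identified with one-variable partials. *)
Lemma ddir_comm (D : R * R -> Prop) (G : R * R -> R) (p : R * R) :
  open D -> Ck 2 D G -> D p ->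
  ddir (fun q => ddir G q (1, 0)) p (0, 1) = ddir (fun q => ddir G q (0, 1)) p (1, 0).
Proof.
intros HD HG Hp; destruct p as [x y].
assert (H1 := Ck_ddir _ _ _ (1, 0) HG); assert (H2 := Ck_ddir _ _ _ (0, 1) HG).
assert (HDp : locally (x, y) D) by now apply HD.
rewrite ddir_fst, ddir_snd.
rewrite (Derive_ext (fun s => ddir G (x, s) (1, 0)) _ _ (fun s => ddir_fst G x s)).
rewrite (Derive_ext (fun s => ddir G (s, y) (0, 1)) _ _ (fun s => ddir_snd G s y)).
symmetry; apply (Schwarz (fun a b => G (a, b))).
- apply locally_2d_locally; revert HDp; apply filter_imp; intros [a b] Hab; simpl.
  repeat split.
  + now apply ex_derive_fst, (Ck_diff 1 D).
  + now apply ex_derive_snd, (Ck_diff 1 D).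
  + apply ex_derive_ext with (fun z => ddir G (z, b) (0, 1)).
    * intros z; apply ddir_snd.
    * apply (ex_derive_fst (fun q => ddir G q (0, 1))), (Ck_diff 0 D); auto.
  + apply ex_derive_ext with (fun z => ddir G (a, z) (1, 0)).
    * intros z; apply ddir_fst.
    * apply (ex_derive_snd (fun q => ddir G q (1, 0))), (Ck_diff 0 D); auto.
- apply continuous_continuity_2d_pt.
  apply continuous_ext with (fun q => ddir (fun q => ddir G q (0, 1)) q (1, 0)).
  + intros [a b]; rewrite ddir_fst; simpl; apply Derive_ext; intros s; apply ddir_snd.
  + exact (Ck_cont 0 D _ (x, y) (Ck_ddir _ _ _ _ H2) Hp).
- apply continuous_continuity_2d_pt.
  apply continuous_ext with (fun q => ddir (fun q => ddir G q (1, 0)) q (0, 1)).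
  + intros [a b]; rewrite ddir_snd; simpl; apply Derive_ext; intros s; apply ddir_fst.
  + exact (Ck_cont 0 D _ (x, y) (Ck_ddir _ _ _ _ H1) Hp).
Qed.

Definition dx (G : R * R -> R) (q : R * R) : R := ddir G q (1, 0).
Definition dy (G : R * R -> R) (q : R * R) : R := ddir G q (0, 1).

Lemma Ck_dx (n : nat) (D : R * R -> Prop) (G : R * R -> R) :
  Ck (S n) D G -> Ck n D (dx G).
Proof. apply Ck_ddir. Qed.

Lemma Ck_dy (n : nat) (D : R * R -> Prop) (G : R * R -> R) :
  Ck (S n) D G -> Ck n D (dy G).
Proof. apply Ck_ddir. Qed.

Lemma ddir_coord (n : nat) (D : R * R -> Prop) (G : R * R -> R) (p u : R * R) :
  Ck (S n) D G -> D p -> ddir G p u = fst u * dx G p + snd u * dy G p.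
Proof. intros HG Hp; now apply ddirE, (Ck_diff n D). Qed.

Lemma is_derive_coord (n : nat) (D : R * R -> Prop) (G : R * R -> R)
    (x y : R -> R) (t x' y' : R) :
  Ck (S n) D G -> D (x t, y t) -> is_derive x t x' -> is_derive y t y' ->
  is_derive (fun s => G (x s, y s)) t (x' * dx G (x t, y t) + y' * dy G (x t, y t)).
Proof.
intros HG Hp Hx Hy.
change (is_derive (fun s => G (x s, y s)) t
  (fst (x', y') * dx G (x t, y t) + snd (x', y') * dy G (x t, y t))).
rewrite <- (ddir_coord n D G _ (x', y') HG Hp).
apply (is_derive_along G (fun s => (x s, y s))).
- now apply (Ck_diff n D).
- now apply is_derive_pair.
Qed.

(** * Covariant derivatives of [F] in coordinates, parallel fields and curvature *)

Section ThriceDifferentiable.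

Variables (D : R * R -> Prop) (F : R * R -> R).
Hypothesis D_H2 : forall p, D p -> H2 p.
Hypothesis D_open : open D.
Hypothesis F_C3 : Ck 3 D F.

Let F_C2 : Ck 2 D F := Ck_pred 2 D F F_C3.

(** Mixed partials agree by [ddir_comm], so three second partials and two first partials determine
    the Hessian. In this form tensor identities become field identities. *)
Lemma hessianE (p u v : R * R) : D p ->
  hessian F p u v =
    fst u * fst v * dx (dx F) p + (fst u * snd v + snd u * fst v) * dy (dx F) p
    + snd u * snd v * dy (dy F) p + (fst u * snd v + snd u * fst v) / snd p * dx F p
    - (fst u * fst v - snd u * snd v) / snd p * dy F p.
Proof.
intros Hp; unfold hessian.
rewrite (ddir_coord 1 D F p) by auto.
rewrite christoffelE by auto.
rewrite (ddir_coord 1 D (fun q => ddir F q u) p v) by (auto; now apply Ck_ddir).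
assert (Hd : forall e, ddir (fun q => ddir F q u) p e
             = fst u * ddir (dx F) p e + snd u * ddir (dy F) p e).
{ intros e; rewrite (ddir_ext_loc _ (fun q => fst u * dx F q + snd u * dy F q)).
  - apply is_derive_unique.
    evar_last.
    + apply (is_derive_plus (fun s => fst u * dx F (plus p (scal s e)))
               (fun s => snd u * dy F (plus p (scal s e))));
      apply is_derive_scal, (is_derive_along _ (fun s => plus p (scal s e)));
        [|apply is_derive_line| |apply is_derive_line]; rewrite line_0;
        [apply (Ck_diff 1 D), Hp; now apply Ck_dx | apply (Ck_diff 1 D), Hp; now apply Ck_dy].
    + now rewrite line_0.
  - generalize (D_open p Hp); apply filter_imp; intros q Hq.
    now apply (ddir_coord 1 D). }
unfold dx at 1, dy at 1; rewrite !Hd.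
fold (dx (dx F) p) (dx (dy F) p) (dy (dx F) p) (dy (dy F) p).
assert (Hs : dy (dx F) p = dx (dy F) p) by now apply (ddir_comm D).
rewrite <- Hs; simpl; unfold Rdiv; ring.
Qed.

(* [u] and [v] are arbitrary vector fields along the curve: constant ones on a line
   compute [cov3], parallel ones turn the right-hand side back into [cov3]. *)
Lemma is_derive_hessian (x y u1 u2 v1 v2 : R -> R) (t x' y' u1' u2' v1' v2' : R) :
  D (x t, y t) ->
  is_derive x t x' -> is_derive y t y' -> is_derive u1 t u1' -> is_derive u2 t u2' ->
  is_derive v1 t v1' -> is_derive v2 t v2' ->
  let p := (x t, y t) in
  is_derive (fun s => hessian F (x s, y s) (u1 s, u2 s) (v1 s, v2 s)) t
    ((u1' * v1 t + u1 t * v1') * dx (dx F) p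
     + u1 t * v1 t * (x' * dx (dx (dx F)) p + y' * dy (dx (dx F)) p)
     + (u1' * v2 t + u1 t * v2' + u2' * v1 t + u2 t * v1') * dy (dx F) p
     + (u1 t * v2 t + u2 t * v1 t)
       * (x' * dx (dy (dx F)) p + y' * dy (dy (dx F)) p)
     + (u2' * v2 t + u2 t * v2') * dy (dy F) p
     + u2 t * v2 t * (x' * dx (dy (dy F)) p + y' * dy (dy (dy F)) p)
     + ((u1' * v2 t + u1 t * v2' + u2' * v1 t + u2 t * v1') / y t
        - (u1 t * v2 t + u2 t * v1 t) * y' / y t ^ 2) * dx F p
     + (u1 t * v2 t + u2 t * v1 t) / y t * (x' * dx (dx F) p + y' * dy (dx F) p)
     - ((u1' * v1 t + u1 t * v1' - u2' * v2 t - u2 t * v2') / y t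
        - (u1 t * v1 t - u2 t * v2 t) * y' / y t ^ 2) * dy F p
     - (u1 t * v1 t - u2 t * v2 t) / y t * (x' * dx (dy F) p + y' * dy (dy F) p)).
Proof.
intros Hp Hx Hy Hu1 Hu2 Hv1 Hv2 p.
assert (Hy0 : y t <> 0) by (apply Rgt_not_eq; exact (D_H2 _ Hp)).
pose proof (is_derive_coord 1 D (dx F) x y t x' y' (Ck_dx _ _ _ F_C3) Hp Hx Hy) as K1.
pose proof (is_derive_coord 1 D (dy F) x y t x' y' (Ck_dy _ _ _ F_C3) Hp Hx Hy) as K2.
pose proof (is_derive_coord 0 D (dx (dx F)) x y t x' y'
             (Ck_dx _ _ _ (Ck_dx _ _ _ F_C3)) Hp Hx Hy) as K11.
pose proof (is_derive_coord 0 D (dy (dx F)) x y t x' y'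
             (Ck_dy _ _ _ (Ck_dx _ _ _ F_C3)) Hp Hx Hy) as K12.
pose proof (is_derive_coord 0 D (dy (dy F)) x y t x' y'
             (Ck_dy _ _ _ (Ck_dy _ _ _ F_C3)) Hp Hx Hy) as K22.
apply is_derive_ext_loc with (fun s =>
    u1 s * v1 s * dx (dx F) (x s, y s)
    + (u1 s * v2 s + u2 s * v1 s) * dy (dx F) (x s, y s)
    + u2 s * v2 s * dy (dy F) (x s, y s)
    + (u1 s * v2 s + u2 s * v1 s) / y s * dx F (x s, y s)
    - (u1 s * v1 s - u2 s * v2 s) / y s * dy F (x s, y s)).
{ assert (Hl : locally t (fun s => D (x s, y s))).
  { refine (locally_curve (fun s => (x s, y s)) t _ D (is_derive_pair _ _ _ _ _ Hx Hy) _).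
    now apply D_open. }
  revert Hl; apply filter_imp; intros s Hs.
  symmetry; exact (hessianE (x s, y s) (u1 s, u2 s) (v1 s, v2 s) Hs). }
(* Naming the partials along the curve as functions of [s] reduces the claim to the product and
   quotient rules in one variable. *)
set (f1 := fun s => dx F (x s, y s)) in *.
set (f2 := fun s => dy F (x s, y s)) in *.
set (f11 := fun s => dx (dx F) (x s, y s)) in *.
set (f12 := fun s => dy (dx F) (x s, y s)) in *.
set (f22 := fun s => dy (dy F) (x s, y s)) in *.
change (dx F p) with (f1 t); change (dy F p) with (f2 t).
change (dx (dx F) p) with (f11 t); change (dy (dx F) p) with (f12 t).
change (dy (dy F) p) with (f22 t).
apply is_derive_ext with (fun s =>
    u1 s * v1 s * f11 s + (u1 s * v2 s + u2 s * v1 s) * f12 s + u2 s * v2 s * f22 s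
    + (u1 s * v2 s + u2 s * v1 s) / y s * f1 s
    - (u1 s * v1 s - u2 s * v2 s) / y s * f2 s); [reflexivity|].
auto_derive.
- repeat split; trivial; eexists; eassumption.
- rewrite (Derive_eta _ _ _ Hy), (Derive_eta _ _ _ Hu1), (Derive_eta _ _ _ Hu2),
    (Derive_eta _ _ _ Hv1), (Derive_eta _ _ _ Hv2),
    (Derive_eta f1 _ _ K1), (Derive_eta f2 _ _ K2),
    (Derive_eta f11 _ _ K11), (Derive_eta f12 _ _ K12), (Derive_eta f22 _ _ K22).
  change (dx (dx F) (x t, y t)) with (f11 t); change (dy (dx F) (x t, y t)) with (f12 t).
  change (dy (dy F) (x t, y t)) with (f22 t).
  unfold p; field; exact Hy0.
Qed.

(** Follows from [is_derive_hessian] along the straight line through [p] with velocity [w], where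
    [u] and [v] are constant. The Christoffel corrections stay as Hessians, to be expanded by
    [hessianE] later. *)
Lemma cov3E (p u v w : R * R) : D p ->
  cov3 F p u v w =
   fst u * fst v * (fst w * dx (dx (dx F)) p + snd w * dy (dx (dx F)) p)
     + (fst u * snd v + snd u * fst v)
       * (fst w * dx (dy (dx F)) p + snd w * dy (dy (dx F)) p)
     + snd u * snd v * (fst w * dx (dy (dy F)) p + snd w * dy (dy (dy F)) p)
     - (fst u * snd v + snd u * fst v) * snd w / snd p ^ 2 * dx F p
     + (fst u * snd v + snd u * fst v) / snd p * (fst w * dx (dx F) p + snd w * dy (dx F) p)
     + (fst u * fst v - snd u * snd v) * snd w / snd p ^ 2 * dy F p
     - (fst u * fst v - snd u * snd v) / snd p * (fst w * dx (dy F) p + snd w * dy (dy F) p)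
   - hessian F p (christoffel p w u) v - hessian F p u (christoffel p w v).
Proof.
intros Hp; unfold cov3; do 2 f_equal.
apply is_derive_unique.
destruct p as [x y], u as [u1 u2], v as [v1 v2], w as [w1 w2].
assert (K := is_derive_hessian (fun s => x + s * w1) (fun s => y + s * w2)
  (fun _ => u1) (fun _ => u2) (fun _ => v1) (fun _ => v2) 0 w1 w2 0 0 0 0).
simpl in K.
replace (x + 0 * w1) with x in K by ring; replace (y + 0 * w2) with y in K by ring.
evar_last.
- apply K; try assumption; auto_derive; trivial; ring.
- assert (y <> 0) by (apply Rgt_not_eq; exact (D_H2 _ Hp)).
  simpl; field; assumption.
Qed.

(** The hypotheses on [u1], [u2], [v1], [v2] are the parallel transport equations
    [u' = - christoffel c c' u]. The product rule then turns the derivatives of the fields into the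
    two Christoffel corrections of [cov3]. *)
Lemma is_derive_hessian_parallel (x y u1 u2 v1 v2 : R -> R) (t x' y' : R) :
  D (x t, y t) -> is_derive x t x' -> is_derive y t y' ->
  is_derive u1 t ((x' * u2 t + y' * u1 t) / y t) ->
  is_derive u2 t ((y' * u2 t - x' * u1 t) / y t) ->
  is_derive v1 t ((x' * v2 t + y' * v1 t) / y t) ->
  is_derive v2 t ((y' * v2 t - x' * v1 t) / y t) ->
  is_derive (fun s => hessian F (x s, y s) (u1 s, u2 s) (v1 s, v2 s)) t
    (cov3 F (x t, y t) (u1 t, u2 t) (v1 t, v2 t) (x', y')).
Proof.
intros Hp Hx Hy Hu1 Hu2 Hv1 Hv2.
assert (Hy0 : y t <> 0) by (apply Rgt_not_eq; exact (D_H2 _ Hp)).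
evar_last.
- now apply is_derive_hessian;
    [| exact Hx | exact Hy | exact Hu1 | exact Hu2 | exact Hv1 | exact Hv2].
- rewrite cov3E by assumption.
  rewrite !christoffelE by exact (D_H2 _ Hp).
  rewrite !hessianE by assumption.
  simpl; field; exact Hy0.
Qed.

(** Partials of order three commute, so exchanging the last two slots leaves only Christoffel terms;
    these assemble into the curvature, whose value -1 fixes the sign. The vector [(- b, a)] is
    [(a, b)] turned by a right angle, and the factor in front is the squared metric length of
    [(a, b)]. *)
Lemma ricci_identity (p : R * R) (a b : R) : D p ->
  cov3 F p (- b, a) (- b, a) (a, b) - cov3 F p (- b, a) (a, b) (- b, a) =
    (a ^ 2 + b ^ 2) / snd p ^ 2 * ddir F p (a, b).
Proof.
intros Hp.
assert (Hy0 : snd p <> 0) by (apply Rgt_not_eq; exact (D_H2 _ Hp)).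
rewrite (ddir_coord 1 D) by assumption.
rewrite !cov3E by assumption.
rewrite !christoffelE by exact (D_H2 _ Hp).
rewrite !hessianE by assumption.
assert (Hs : forall q, D q -> dy (dx F) q = dx (dy F) q)
  by (intros q Hq; now apply (ddir_comm D)).
assert (H1 : dx (dy (dx F)) p = dy (dx (dx F)) p)
  by (symmetry; apply (ddir_comm D (dx F)); trivial; now apply Ck_dx).
assert (H3 : dx (dy (dy F)) p = dy (dy (dx F)) p).
{ transitivity (dy (dx (dy F)) p).
  - symmetry; apply (ddir_comm D (dy F)); trivial; now apply Ck_dy.
  - apply ddir_ext_loc; generalize (D_open p Hp); apply filter_imp; intros q Hq.
    symmetry; now apply Hs. }
rewrite H1, H3, <- (Hs p Hp); simpl; field; exact Hy0.
Qed.

(** For a parallel field the product rule leaves only the covariant derivative of the differential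
    of [F], which is the Hessian. *)
Lemma is_derive_ddir_parallel (x y u1 u2 : R -> R) (t x' y' : R) :
  D (x t, y t) -> is_derive x t x' -> is_derive y t y' ->
  is_derive u1 t ((x' * u2 t + y' * u1 t) / y t) ->
  is_derive u2 t ((y' * u2 t - x' * u1 t) / y t) ->
  is_derive (fun s => ddir F (x s, y s) (u1 s, u2 s)) t
    (hessian F (x t, y t) (u1 t, u2 t) (x', y')).
Proof.
intros Hp Hx Hy Hu1 Hu2.
assert (Hy0 : y t <> 0) by (apply Rgt_not_eq; exact (D_H2 _ Hp)).
set (f1 := fun s => dx F (x s, y s)); set (f2 := fun s => dy F (x s, y s)).
assert (K1 := is_derive_coord 0 D (dx F) x y t x' y'
  (Ck_pred 1 _ _ (Ck_dx _ _ _ F_C3)) Hp Hx Hy).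
assert (K2 := is_derive_coord 0 D (dy F) x y t x' y'
  (Ck_pred 1 _ _ (Ck_dy _ _ _ F_C3)) Hp Hx Hy).
assert (Hs : dy (dx F) (x t, y t) = dx (dy F) (x t, y t)) by now apply (ddir_comm D).
apply is_derive_ext_loc with (fun s => u1 s * f1 s + u2 s * f2 s).
{ assert (Hl : locally t (fun s => D (x s, y s))).
  { refine (locally_curve (fun s => (x s, y s)) t _ D (is_derive_pair _ _ _ _ _ Hx Hy) _).
    now apply D_open. }
  revert Hl; apply filter_imp; intros s Hsd.
  symmetry; exact (ddir_coord 1 D F (x s, y s) (u1 s, u2 s) F_C2 Hsd). }
auto_derive.
- repeat split; eexists; [exact Hu1 | exact K1 | exact Hu2 | exact K2].
- rewrite (Derive_eta _ _ _ Hu1), (Derive_eta _ _ _ Hu2),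
    (Derive_eta f1 _ _ K1), (Derive_eta f2 _ _ K2), hessianE by assumption.
  unfold f1, f2; rewrite <- Hs; simpl; field; exact Hy0.
Qed.

End ThriceDifferentiable.

(** * Scalar comparison inequalities along a geodesic *)

Lemma derive_nonneg_le (f df : R -> R) (a b : R) :
  a <= b -> (forall t, a <= t <= b -> is_derive f t (df t)) ->
  (forall t, a <= t <= b -> 0 <= df t) -> f a <= f b.
Proof.
intros Hab Hf Hdf.
destruct (MVT_gen f a b df) as [c [Hc E]].
- intros t Ht; apply Hf; rewrite Rmin_left, Rmax_right in Ht; lra.
- intros t Ht; rewrite Rmin_left, Rmax_right in Ht by lra.
  apply continuity_pt_filterlim, (ex_derive_continuous f).
  eexists; apply Hf, Ht.
- rewrite Rmin_left, Rmax_right in Hc by lra.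
  assert (Hd := Hdf c Hc); nra.
Qed.

(** Isolates the one-variable argument from the geometry: [psi] and [k] stand for [nabla^3 F(T,T,T)]
    and [nabla^3 F(n,n,T)]. The work is done with [q = / sqrt phi], for which self-concordance gives
    linear bounds. *)
Lemma selfconcordant_profile_bound (T theta : R) (f' phi psi h k : R -> R) :
  1 <= T ->
  (forall t, 0 <= t <= T -> is_derive f' t (phi t)) ->
  (forall t, 0 <= t <= T -> is_derive phi t (psi t)) ->
  (forall t, 0 <= t <= T -> is_derive h t (k t)) ->
  (forall t, 0 <= t <= T -> 0 < phi t) ->
  (forall t, 0 <= t <= T -> Rabs (psi t) <= 2 * phi t * sqrt (phi t)) ->
  (forall t, 0 <= t <= T -> Rabs (k t) <= 2 * h t * sqrt (phi t)) ->
  (forall t, 0 <= t <= T -> f' t <= 4 * h t * sqrt (phi t)) ->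
  (forall t, 0 <= t <= T -> 0 <= h t) ->
  (forall t, 0 <= t <= T -> f' t / sqrt (phi t) <= sqrt theta) ->
  0 <= theta -> f' 0 = 0 -> h 0 <= phi 0 ->
  T - 1 <= 72 * theta.
Proof.
intros HT Df Dphi Dh Hphi Hpsi Hk Hric Hh Hth Hth0 Hf0 Hh0.
(* Self-concordance says exactly that [q] is 1-Lipschitz. *)
set (q := fun t => / sqrt (phi t)).
assert (Hsq : forall t, 0 <= t <= T -> 0 < sqrt (phi t))
  by (intros; now apply sqrt_lt_R0, Hphi).
assert (Hqpos : forall t, 0 <= t <= T -> 0 < q t)
  by (intros; now apply Rinv_0_lt_compat, Hsq).
assert (Hss : forall t, 0 <= t <= T -> sqrt (phi t) * sqrt (phi t) = phi t)
  by (intros; apply sqrt_sqrt; left; auto).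
set (dq := fun t => - psi t / (2 * phi t * sqrt (phi t))).
assert (Dq : forall t, 0 <= t <= T -> is_derive q t (dq t)).
{ intros t Ht; assert (H1 := Hsq t Ht); assert (H2 := Hss t Ht); assert (H3 := Hphi t Ht).
  unfold q, dq; auto_derive.
  - repeat split; [eexists; now apply Dphi | exact H3 | lra].
  - rewrite (Derive_eta phi t _ (Dphi t Ht)).
    rewrite H2; field; split; lra. }
assert (Bq : forall t, 0 <= t <= T -> -1 <= dq t <= 1).
{ intros t Ht; assert (H1 := Hsq t Ht); assert (H3 := Hphi t Ht).
  assert (H4 : 0 < 2 * phi t * sqrt (phi t)) by (apply Rmult_lt_0_compat; lra).
  apply Rabs_le_between; unfold dq, Rdiv; rewrite Rabs_mult, Rabs_Ropp, Rabs_inv.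
  rewrite (Rabs_pos_eq (2 * phi t * sqrt (phi t))) by lra.
  apply Rmult_le_reg_r with (2 * phi t * sqrt (phi t)); [exact H4|].
  rewrite Rmult_assoc, Rinv_l, Rmult_1_r, Rmult_1_l by lra; auto. }
assert (Uq : forall t, 0 <= t <= T -> q t <= q 0 + t).
{ intros t Ht.
  assert (H := derive_nonneg_le (fun s => s - q s) (fun s => 1 - dq s) 0 t).
  simpl in H; enough (0 - q 0 <= t - q t) by lra; apply H; [lra| |].
  - intros s Hs; apply (is_derive_minus (fun s => s) q);
      [exact (is_derive_id (s : R_AbsRing)) | apply Dq; lra].
  - intros s Hs; assert (B := Bq s); lra. }
assert (Lq : forall t, 0 <= t <= T -> q 0 - t <= q t).
{ intros t Ht.
  assert (H := derive_nonneg_le (fun s => s + q s) (fun s => 1 + dq s) 0 t).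
  simpl in H; enough (0 + q 0 <= t + q t) by lra; apply H; [lra| |].
  - intros s Hs; apply (is_derive_plus (fun s => s) q);
      [exact (is_derive_id (s : R_AbsRing)) | apply Dq; lra].
  - intros s Hs; assert (B := Bq s); lra. }
assert (Ephi : forall t, 0 <= t <= T -> phi t = / (q t * q t)).
{ intros t Ht; unfold q; rewrite <- (Hss t Ht) at 1; field; apply Rgt_not_eq, Hsq, Ht. }
assert (Esq : forall t, 0 <= t <= T -> sqrt (phi t) = / q t).
{ intros t Ht; unfold q; now rewrite Rinv_inv. }
assert (Q0 : 0 < q 0) by (apply Hqpos; lra).
(* By [Uq], [phi s] is at least [/ (q 0 + s) ^ 2]; integrating from [f' 0 = 0] gives
   [/ q 0 - / (q 0 + 1)]. *)
assert (Lf : / (q 0 * (q 0 + 1)) <= f' 1).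
{ assert (H := derive_nonneg_le (fun s => f' s + / (q 0 + s))
    (fun s => phi s - / ((q 0 + s) * (q 0 + s))) 0 1).
  simpl in H.
  enough (f' 0 + / (q 0 + 0) <= f' 1 + / (q 0 + 1)).
  { replace (/ (q 0 * (q 0 + 1))) with (/ q 0 - / (q 0 + 1)) by (field; lra).
    rewrite Rplus_0_r in H0; lra. }
  apply H; [lra| |].
  - intros s Hs; auto_derive.
    + repeat split; [eexists; apply Df; lra | lra].
    + rewrite (Derive_eta f' s _ (Df s ltac:(lra))); field; lra.
  - intros s Hs; rewrite (Ephi s) by lra.
    assert (U := Uq s ltac:(lra)); assert (P := Hqpos s ltac:(lra)).
    enough (/ ((q 0 + s) * (q 0 + s)) <= / (q s * q s)) by lra.
    apply Rinv_le_contravar; nra. }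
(* Otherwise the Ricci bound contradicts [Lf]: it gives [f' 1 * (q 0 - 1) ^ 3 <= 4], while
   [4 * q * (q + 1) < (q - 1) ^ 3] for [q > 8]. At 8 the two sides are 288 and 343, whereas at 7 the
   inequality fails. *)
assert (Q8 : q 0 <= 8).
{ destruct (Rle_or_lt (q 0) 8) as [|HQ]; [assumption|exfalso].
  assert (Hh1 : h 1 * (q 0 - 1) ^ 2 <= h 0 * (q 0) ^ 2).
  (* The product [h s * (q 0 - s) ^ 2] is nonincreasing, because [k <= 2 * h / q] and
     [q s >= q 0 - s]. *)
  { assert (H := derive_nonneg_le (fun s => - (h s * (q 0 - s) ^ 2))
      (fun s => (2 * h s * (q 0 - s) - k s * (q 0 - s) ^ 2)) 0 1).
    simpl in H.
    enough (- (h 0 * ((q 0 - 0) * ((q 0 - 0) * 1))) <= - (h 1 * ((q 0 - 1) * ((q 0 - 1) * 1))))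
      by (simpl; rewrite Rminus_0_r in H0; lra).
    apply H; [lra| |].
    - intros s Hs; auto_derive.
      + repeat split; eexists; apply Dh; lra.
      + rewrite (Derive_eta h s _ (Dh s ltac:(lra))); ring.
    - intros s Hs.
      assert (L := Lq s ltac:(lra)); assert (P := Hqpos s ltac:(lra)).
      assert (K := Hk s ltac:(lra)); assert (K2 := Hh s ltac:(lra)).
      assert (K3 := Rle_abs (k s)).
      rewrite (Esq s) in K by lra.
      assert (K4 : k s * q s <= 2 * h s).
      { replace (2 * h s) with (2 * h s * / q s * q s) by (field; lra).
        apply Rmult_le_compat_r; lra. }
      (* For [k s >= 0], [q s] is replaced by the smaller [q 0 - s]; for [k s < 0] the left side is
         negative. *)
      assert (K5 : k s * (q 0 - s) <= 2 * h s) by (destruct (Rle_or_lt 0 (k s)); nra).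
      nra. }
  assert (Hh0' : h 0 * (q 0) ^ 2 <= 1).
  { rewrite (Ephi 0) in Hh0 by lra.
    apply Rle_trans with (/ (q 0 * q 0) * (q 0) ^ 2).
    - apply Rmult_le_compat_r; [apply pow2_ge_0|assumption].
    - right; field; lra. }
  assert (Hr := Hric 1 ltac:(lra)); rewrite (Esq 1) in Hr by lra.
  assert (L := Lq 1 ltac:(lra)); assert (P := Hqpos 1 ltac:(lra)).
  assert (K2 := Hh 1 ltac:(lra)).
  assert (X1 : f' 1 * (q 0 - 1) ^ 3 <= 4).
  { apply Rle_trans with (4 * h 1 * / (q 0 - 1) * (q 0 - 1) ^ 3).
    - apply Rmult_le_compat_r; [apply pow_le; lra|].
      apply Rle_trans with (1 := Hr), Rmult_le_compat_l; [lra|].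
      apply Rinv_le_contravar; lra.
    - replace (4 * h 1 * / (q 0 - 1) * (q 0 - 1) ^ 3) with (4 * (h 1 * (q 0 - 1) ^ 2))
        by (field; lra).
      lra. }
  assert (X2 : 1 <= f' 1 * (q 0 * (q 0 + 1))).
  { replace 1 with (/ (q 0 * (q 0 + 1)) * (q 0 * (q 0 + 1))) at 1 by (field; lra).
    apply Rmult_le_compat_r; [nra|assumption]. }
  assert (X3 : 4 * (q 0 * (q 0 + 1)) < (q 0 - 1) ^ 3) by nra.
  assert (X4 : 0 < f' 1) by nra.
  nra. }
(* Here 72 is [8 * (8 + 1)], from [Q8] inserted in [Lf]. *)
assert (Lf' : / 72 <= f' 1).
{ apply Rle_trans with (2 := Lf); apply Rinv_le_contravar; nra. }
assert (Lft : forall t, 1 <= t <= T -> f' 1 <= f' t).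
{ intros t Ht; apply (derive_nonneg_le f' phi); [lra| |].
  - intros s Hs; apply Df; lra.
  - intros s Hs; left; apply Hphi; lra. }
(* Squaring the gradient bound is legitimate since [f' t >= f' 1 > 0]. *)
assert (Hft : forall t, 1 <= t <= T -> f' t * f' t <= theta * phi t).
{ intros t Ht.
  assert (X := Hth t ltac:(lra)); assert (X2 := Lft t Ht).
  assert (X3 := Hsq t ltac:(lra)).
  assert (X4 : f' t <= sqrt theta * sqrt (phi t)).
  { replace (f' t) with (f' t / sqrt (phi t) * sqrt (phi t)) by (field; lra).
    apply Rmult_le_compat_r; lra. }
  rewrite <- (Hss t) by lra; rewrite <- (sqrt_sqrt theta) by assumption.
  nra. }
(* Rearranged, this is [T - 1 <= theta / f' 1 - theta / f' T]; the last term is dropped by its sign.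
   It holds because [- s - theta / f' s] is nondecreasing by [Hft]. *)
assert (Hfin : 1 + - theta * / f' 1 <= 1 - T + (1 + - theta * / f' T)).
2:{ assert (X := Lft T ltac:(lra)).
    assert (0 <= theta * / f' T)
      by (apply Rmult_le_pos; [lra|left; apply Rinv_0_lt_compat; lra]).
    assert (/ f' 1 <= 72).
    { rewrite <- (Rinv_inv 72); apply Rinv_le_contravar; lra. }
    nra. }
assert (H := derive_nonneg_le (fun s => - s - theta * / f' s)
  (fun s => theta * phi s / (f' s * f' s) - 1) 1 T).
simpl in H; enough (- (1) - theta * / f' 1 <= - T - theta * / f' T) by lra.
apply H; [lra| |].
- intros s Hs; assert (X := Lft s Hs); auto_derive.
  + repeat split; [eexists; apply Df; lra | lra].
  + rewrite (Derive_eta f' s _ (Df s ltac:(lra))); field; lra.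
- intros s Hs; assert (X := Lft s Hs); assert (X2 := Hft s Hs).
  enough (1 <= theta * phi s / (f' s * f' s)) by lra.
  apply Rmult_le_reg_r with (f' s * f' s); [nra|].
  unfold Rdiv; rewrite Rmult_assoc, Rinv_l by nra; lra.
Qed.

(** * Explicit unit-speed geodesics of the half-plane and distances along them *)

Definition den (b t : R) : R := cosh t - b * sinh t.
(* The unit-speed geodesic from [(x0, y0)] with initial velocity [(a * y0, b * y0)],
   where [a ^ 2 + b ^ 2 = 1], vertical lines included. *)
Definition geo_x (x0 y0 a b t : R) : R := x0 + a * y0 * sinh t / den b t.
Definition geo_y (y0 b t : R) : R := y0 / den b t.
Definition geo_x' (y0 a b t : R) : R := a * y0 / den b t ^ 2.
Definition geo_y' (y0 b t : R) : R := y0 * (b * cosh t - sinh t) / den b t ^ 2.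

Lemma cosh2_sinh2 (t : R) : cosh t ^ 2 = 1 + sinh t ^ 2.
Proof.
unfold cosh, sinh; assert (E : exp t * exp (- t) = 1)
  by (rewrite <- exp_plus, Rplus_opp_r; apply exp_0).
nra.
Qed.

(** Twice [den b t] is [(1 - b) * exp t + (1 + b) * exp (- t)], whose coefficients are nonnegative
    and sum to 2. *)
Lemma den_pos (a b t : R) : a ^ 2 + b ^ 2 = 1 -> 0 < den b t.
Proof.
intros Hab; unfold den, cosh, sinh.
assert (0 < exp t) by apply exp_pos; assert (0 < exp (- t)) by apply exp_pos.
assert (Hb : -1 <= b <= 1) by nra.
assert (0 <= (1 - b) * exp t) by (apply Rmult_le_pos; lra).
assert (0 <= (1 + b) * exp (- t)) by (apply Rmult_le_pos; lra).
destruct (Rle_or_lt b 0); nra.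
Qed.


Section Geodesic.

Variables x0 y0 a b : R.
Hypothesis unit_ab : a ^ 2 + b ^ 2 = 1.
Hypothesis y0_pos : 0 < y0.

Lemma geo_y_pos (t : R) : 0 < geo_y y0 b t.
Proof. apply Rdiv_lt_0_compat; [assumption|now apply den_pos with a]. Qed.

Lemma geo_x_derive (t : R) : is_derive (geo_x x0 y0 a b) t (geo_x' y0 a b t).
Proof.
assert (Hd := den_pos a b t unit_ab); assert (E := cosh2_sinh2 t).
unfold geo_x, geo_x', den in *; auto_derive; [lra|].
field_simplify_eq; [ring [E]|lra].
Qed.

Lemma geo_y_derive (t : R) : is_derive (geo_y y0 b) t (geo_y' y0 b t).
Proof.
assert (Hd := den_pos a b t unit_ab).
unfold geo_y, geo_y', den in *; auto_derive; [lra|].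
field; lra.
Qed.

Lemma geo_speed (t : R) :
  geo_x' y0 a b t ^ 2 + geo_y' y0 b t ^ 2 = geo_y y0 b t ^ 2.
Proof.
assert (Hd := den_pos a b t unit_ab); assert (E := cosh2_sinh2 t).
assert (A : a ^ 2 = 1 - b ^ 2) by lra.
unfold geo_x', geo_y, geo_y', den in *.
field_simplify_eq; [ring [E A]|lra].
Qed.

(** Together with [geo_y'_derive] this is the geodesic equation, written as parallel transport of
    the velocity along itself, the form used by [is_derive_hessian_parallel]. *)
Lemma geo_x'_derive (t : R) :
  is_derive (geo_x' y0 a b) t
    ((geo_x' y0 a b t * geo_y' y0 b t + geo_y' y0 b t * geo_x' y0 a b t) / geo_y y0 b t).
Proof.
assert (Hd := den_pos a b t unit_ab).
unfold geo_x', geo_y, geo_y', den in *; auto_derive.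
- apply Rgt_not_eq; nra.
- field; lra.
Qed.

Lemma geo_y'_derive (t : R) :
  is_derive (geo_y' y0 b) t
    ((geo_y' y0 b t * geo_y' y0 b t - geo_x' y0 a b t * geo_x' y0 a b t) / geo_y y0 b t).
Proof.
assert (Hd := den_pos a b t unit_ab); assert (E := cosh2_sinh2 t).
assert (A : a ^ 2 = 1 - b ^ 2) by lra.
unfold geo_x', geo_y, geo_y', den in *; auto_derive.
- apply Rgt_not_eq; nra.
- field_simplify_eq; [ring [E A]|lra].
Qed.

End Geodesic.

(* [0 <= path_length c c'] covers the case where [real] sends an infinite bound to 0. *)
Lemma dist_le_length (p q : R * R) (c c' : R -> R * R) :
  C1_path p q c c' -> 0 <= path_length c c' -> Defs.dist p q <= path_length c c'.
Proof.
intros Hc Hl; unfold Defs.dist.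
assert (H : Rbar_le (Glb_Rbar (fun l => exists c c', C1_path p q c c' /\ l = path_length c c'))
              (path_length c c')).
{ apply (proj1 (Glb_Rbar_correct _)); now exists c, c'. }
destruct (Glb_Rbar _); simpl in *; [exact H | contradiction | exact Hl].
Qed.

Lemma geo_0 (x0 y0 a b : R) :
  (geo_x x0 y0 a b 0, geo_y y0 b 0) = (x0, y0) /\
  (geo_x' y0 a b 0, geo_y' y0 b 0) = (a * y0, b * y0).
Proof.
unfold geo_x, geo_y, geo_x', geo_y', den; rewrite sinh_0, cosh_0.
split; f_equal; field.
Qed.

(** The geodesic, rescaled to constant speed [T] on the unit interval, is a competitor in the
    infimum defining the distance. *)
Lemma dist_geo_le (x0 y0 a b T : R) :
  a ^ 2 + b ^ 2 = 1 -> 0 < y0 -> 0 <= T ->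
  Defs.dist (x0, y0) (geo_x x0 y0 a b T, geo_y y0 b T) <= T.
Proof.
intros Hab Hy0 HT.
set (c := fun s => (geo_x x0 y0 a b (T * s), geo_y y0 b (T * s))).
set (c' := fun s => (T * geo_x' y0 a b (T * s), T * geo_y' y0 b (T * s))).
assert (HL : path_length c c' = T).
{ unfold path_length; transitivity (RInt (fun _ => T) 0 1).
  - apply RInt_ext; intros s _; transitivity (sqrt (T ^ 2)); [apply f_equal|now apply sqrt_pow2].
    assert (E := geo_speed y0 a b Hab (T * s)).
    assert (P := geo_y_pos y0 a b Hab Hy0 (T * s)).
    unfold metric, c, c'; cbn [fst snd].
    replace (T * geo_x' y0 a b (T * s) * (T * geo_x' y0 a b (T * s)) +
             T * geo_y' y0 b (T * s) * (T * geo_y' y0 b (T * s)))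
      with (T ^ 2 * geo_y y0 b (T * s) ^ 2) by (rewrite <- E; ring).
    field; lra.
  - rewrite RInt_const; unfold scal; simpl; unfold mult; simpl; ring. }
rewrite <- HL at 3; apply dist_le_length; [|now rewrite HL].
destruct (geo_0 x0 y0 a b) as [E0 _].
split; [|split].
- unfold c; rewrite Rmult_0_r; exact E0.
- unfold c; now rewrite Rmult_1_r.
- assert (Hlin : forall s, is_derive (fun s => T * s) s T)
    by (intros s; auto_derive; trivial; ring).
  intros s Hs; split; [|split].
  + exact (geo_y_pos y0 a b Hab Hy0 (T * s)).
  + apply is_derive_pair.
    * exact (is_derive_comp _ _ s _ _ (geo_x_derive x0 y0 a b Hab (T * s)) (Hlin s)).
    * exact (is_derive_comp _ _ s _ _ (geo_y_derive y0 a b Hab (T * s)) (Hlin s)).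
  + apply (ex_derive_continuous (V := prod_NormedModule _ R_NormedModule R_NormedModule)).
    eexists; apply is_derive_pair.
    * apply is_derive_scal.
      exact (is_derive_comp _ _ s _ _ (geo_x'_derive y0 a b Hab Hy0 (T * s)) (Hlin s)).
    * apply is_derive_scal.
      exact (is_derive_comp _ _ s _ _ (geo_y'_derive y0 a b Hab Hy0 (T * s)) (Hlin s)).
Qed.

(** * The barrier along geodesics from its center, and the final bound *)

Lemma ddir_center (D : R * R -> Prop) (F : R * R -> R) (p u : R * R) :
  open D -> Ck 1 D F -> analytic_center D F p -> ddir F p u = 0.
Proof.
intros HD HF [Hp Hmin].
assert (Hd : is_derive (fun t : R => F (plus p (scal t u))) 0 (ddir F p u)).
{ evar_last.
  - apply (is_derive_along F (fun t => plus p (scal t u))); [|apply is_derive_line].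
    rewrite line_0; now apply (Ck_diff 0 D).
  - now rewrite line_0. }
assert (Hl : locally 0 (fun s : R => D (plus p (scal s u)))).
{ apply locally_line; now apply HD. }
destruct Hl as [eps Heps].
set (pr := exist _ _ (proj1 (is_derive_Reals _ _ _) Hd)
           : derivable_pt (fun t : R => F (plus p (scal t u))) 0).
change (derive_pt (fun t : R => F (plus p (scal t u))) 0 pr = 0).
apply (deriv_minimum _ (- eps) eps); try (destruct eps; simpl; lra).
intros s H1 H2; rewrite line_0; apply Hmin, Heps.
apply Rabs_lt_between; unfold minus, plus, opp; simpl; lra.
Qed.

Lemma barrier_geodesic_bound (D : R * R -> Prop) (F : R * R -> R)
    (x0 y0 a b T theta : R) :
  (forall p, D p -> H2 p) -> open D -> barrier theta D F ->
  analytic_center D F (x0, y0) -> a ^ 2 + b ^ 2 = 1 -> 1 <= T ->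
  (forall t, 0 <= t <= T -> D (geo_x x0 y0 a b t, geo_y y0 b t)) ->
  hessian F (x0, y0) (- (b * y0), a * y0) (- (b * y0), a * y0)
    <= hessian F (x0, y0) (a * y0, b * y0) (a * y0, b * y0) ->
  T - 1 <= 72 * theta.
Proof.
intros D_H2 D_open [Hth [[F_C3 [Hsc _]] [Hpos Hgrad]]] Hcen Hab HT HD Hab0.
assert (Hy0 : 0 < y0) by exact (D_H2 _ (proj1 Hcen)).
set (x := geo_x x0 y0 a b) in *; set (y := geo_y y0 b) in *.
set (x' := geo_x' y0 a b); set (y' := geo_y' y0 b).
assert (Hx : forall t, is_derive x t (x' t)) by now apply geo_x_derive.
assert (Hy : forall t, is_derive y t (y' t)) by now apply geo_y_derive with a.
assert (Hx' := geo_x'_derive y0 a b Hab Hy0 : forall t,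
  is_derive x' t ((x' t * y' t + y' t * x' t) / y t)).
assert (Hy' := geo_y'_derive y0 a b Hab Hy0 : forall t,
  is_derive y' t ((y' t * y' t - x' t * x' t) / y t)).
(* The chart is conformal, so the velocity turned by a right angle is the normal of the same length,
   and it is again parallel; [Hn] and [Hn2] are its transport equations. *)
assert (Hn : forall t, is_derive (fun s => - y' s) t ((x' t * x' t + y' t * - y' t) / y t)).
{ intros t; evar_last; [exact (is_derive_opp y' t _ (Hy' t))|].
  unfold opp; simpl; unfold Rdiv; ring. }
assert (Hn2 : forall t, is_derive x' t ((y' t * x' t - x' t * - y' t) / y t)).
{ intros t; evar_last; [apply Hx'|]; unfold Rdiv; ring. }
assert (Hspeed := geo_speed y0 a b Hab : forall t, x' t ^ 2 + y' t ^ 2 = y t ^ 2).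
assert (Hyp := geo_y_pos y0 a b Hab Hy0 : forall t, 0 < y t).
destruct (geo_0 x0 y0 a b) as [E0 E0'].
assert (NT : forall t, (x' t, y' t) <> (0, 0)).
{ intros t [= N1 N2]; assert (S := Hspeed t); assert (P := Hyp t); rewrite N1, N2 in S; nra. }
assert (NN : forall t, (- y' t, x' t) <> (0, 0)).
{ intros t [= N1 N2]; assert (S := Hspeed t); assert (P := Hyp t); rewrite N2 in S; nra. }
apply (selfconcordant_profile_bound T theta
  (fun t => ddir F (x t, y t) (x' t, y' t))
  (fun t => hessian F (x t, y t) (x' t, y' t) (x' t, y' t))
  (fun t => cov3 F (x t, y t) (x' t, y' t) (x' t, y' t) (x' t, y' t))
  (fun t => hessian F (x t, y t) (- y' t, x' t) (- y' t, x' t))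
  (fun t => cov3 F (x t, y t) (- y' t, x' t) (- y' t, x' t) (x' t, y' t))); trivial.
- intros t Ht; apply (is_derive_ddir_parallel D); auto.
- intros t Ht; apply (is_derive_hessian_parallel D); auto.
- intros t Ht; apply (is_derive_hessian_parallel D F D_H2 D_open F_C3 x y
    (fun s => - y' s) x' (fun s => - y' s) x'); auto.
- intros t Ht; apply Hpos; auto.
- intros t Ht; apply Rle_trans with (1 := Hsc _ _ _ _ (HD t Ht)); right.
  rewrite (Rmult_assoc 2), sqrt_sqrt by (left; apply Hpos; auto); reflexivity.
- intros t Ht; apply Rle_trans with (1 := Hsc _ _ _ _ (HD t Ht)); right.
  rewrite (Rmult_assoc 2), sqrt_sqrt by (left; apply Hpos; auto); reflexivity.
(* Unit speed makes the factor in [ricci_identity] equal to 1, so [f'] is a difference of two third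
   derivatives, each at most [2 * h * sqrt phi] in absolute value. *)
- intros t Ht.
  assert (R := ricci_identity D F D_H2 D_open F_C3 (x t, y t) (x' t) (y' t) (HD t Ht)).
  cbn [snd] in R; rewrite Hspeed in R.
  replace (y t ^ 2 / y t ^ 2) with 1 in R by (field; apply Rgt_not_eq, Hyp).
  assert (S1 := Hsc _ (- y' t, x' t) (- y' t, x' t) (x' t, y' t) (HD t Ht)).
  assert (S2 := Hsc _ (- y' t, x' t) (x' t, y' t) (- y' t, x' t) (HD t Ht)).
  assert (SQ := sqrt_sqrt _ (Rlt_le _ _ (Hpos _ (- y' t, x' t) (HD t Ht) (NN t)))).
  apply Rabs_le_between in S1; apply Rabs_le_between in S2.
  set (hn := sqrt (hessian F (x t, y t) (- y' t, x' t) (- y' t, x' t))) in *.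
  rewrite <- SQ; lra.
- intros t Ht; left; apply Hpos; auto.
- intros t Ht.
  assert (G := Hgrad _ (x' t, y' t) (HD t Ht) (NT t)).
  replace (ddir F (x t, y t) (x' t, y' t))
    with (metric (x t, y t) (gradient F (x t, y t)) (x' t, y' t)); [exact G|].
  rewrite (ddir_coord 1 D F _ _ (Ck_pred _ _ _ F_C3) (HD t Ht)).
  unfold gradient, metric, sharp, dx, dy; cbn [fst snd]; field.
  apply Rgt_not_eq, Hyp.
- simpl; unfold x, y, x', y'; rewrite E0, E0'.
  apply (ddir_center D); trivial; now do 2 apply Ck_pred.
- simpl; unfold x, y, x', y'; rewrite E0; injection E0' as -> ->; exact Hab0.
Qed.

Theorem theorem1p3 (D : R * R -> Prop) (p0 : R * R) (r Rad theta : R)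
    (F : R * R -> R)
    (D_sub : forall p, D p -> H2 p)
    (D_open : open D)
    (D_convex : g_convex D)
    (p0_H2 : H2 p0)
    (r_pos : 0 < r)
    (r_le_Rad : r <= Rad)
    (ball_sub_D : forall p, Hball p0 r p -> D p)
    (D_sub_ball : forall p, D p -> Hball p0 Rad p)
    (F_barrier : barrier theta D F)
    (F_center : analytic_center D F p0) :
  theta >= 1 / 2 ^ 6 * sqrt r * (r / Rad) - 1 / 2.
Proof.
assert (Hratio : r / Rad <= 1).
{ apply Rmult_le_reg_r with Rad; [lra|]; unfold Rdiv.
  rewrite Rmult_assoc, Rinv_l, Rmult_1_l by lra; lra. }
assert (Hratio0 : 0 <= r / Rad) by (apply Rmult_le_pos; [lra|left; apply Rinv_0_lt_compat; lra]).
assert (Hs0 := sqrt_pos r).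
assert (Hss : sqrt r * sqrt r = r) by (apply sqrt_sqrt; lra).
assert (Hth := proj1 F_barrier).
(* As [r / Rad <= 1], the ratio may be replaced by 1. The resulting bound is at most 0 when
   [sqrt r <= 32], where [0 <= theta] suffices. *)
apply Rle_ge, Rle_trans with (sqrt r / 64 - 1 / 2); [nra|].
destruct (Rle_or_lt (sqrt r) 32) as [|Hbig]; [lra|].
enough (r / 2 - 1 <= 72 * theta) by nra.
destruct p0 as [x0 y0]; unfold H2 in p0_H2; simpl in p0_H2.
(* Stopping at time [r / 2] keeps the closed time interval inside the open ball; [sqrt r > 32] makes
   this time exceed 1. *)
assert (HD : forall a b, a ^ 2 + b ^ 2 = 1 -> forall t, 0 <= t <= r / 2 ->
             D (geo_x x0 y0 a b t, geo_y y0 b t)).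
{ intros a b Hab t Ht; apply ball_sub_D; split; [now apply geo_y_pos with a|].
  apply Rle_lt_trans with t; [now apply dist_geo_le|lra]. }
assert (HE := hessianE D F D_sub D_open (proj1 (proj1 (proj2 F_barrier)))
                (x0, y0)).
(* The geodesic starts horizontally or vertically, whichever unit direction has the larger Hessian.
   In the vertical case the normal is [(- y0, 0)], and its sign disappears in the quadratic form. *)
destruct (Rle_or_lt (hessian F (x0, y0) (0, y0) (0, y0))
                    (hessian F (x0, y0) (y0, 0) (y0, 0))) as [H|H].
- apply (barrier_geodesic_bound D F x0 y0 1 0); trivial; try nra.
  + apply HD; ring.
  + rewrite !HE in H |- * by exact (proj1 F_center); cbn [fst snd] in *; nra.
- apply (barrier_geodesic_bound D F x0 y0 0 1); trivial; try nra.
  + apply HD; ring.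
  + rewrite !HE in H |- * by exact (proj1 F_center); cbn [fst snd] in *; nra.
Qed.
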